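(* Let $\pi$ be a monotone probability mass function on the set $\mathcal{X}=S^V$ of spin configurations. Fix a site $v\in V$, and suppose that the conditional distributions under $\pi$ of the spin at $v$ given the spins at all sites other than $v$ all have positive correlations. Let $K_v$ be the (stochastically monotone) Markov kernel for update at site $v$ according to these conditional distributions. Then we have the comparison inequality $K_v\preceq I$, where $I$ is the identity kernel.
   Context: $G=(V,E)$ is a finite graph and $S$ is a finite partially ordered set of ''spin values''. A spin configuration is an assignment of spins to vertices (sites); $\mathcal{X}=S^V$ is the set of all configurations, with the coordinatewise partial order. $\pi$ is a probability mass function on $\mathcal{X}$ with $\pi(x)>0$ for all $x$. $\pi$ is monotone if, for every site $v$, the conditional law under $\pi$ of the spin at $v$ given the spins at all other sites is stochastically monotone (increasing) in the conditioning spins. Writing $[x]$ for the set of configurations that agree with $x$ at all sites other than $v$, the update kernel is $K_v(x,y)=\mathbf{1}(y\in[x])\,\pi(y)/\pi([x])$. A probability mass function $\rho$ on a finite partially ordered set has positive correlations if $\sum_i\rho(i)f(i)g(i)\ge\left(\sum_i\rho(i)f(i)\right)\left(\sum_i\rho(i)g(i)\right)$ for all nonnegative nonincreasing functions $f,g$. Let $\mathcal{M}$ be the set of nonnegative nonincreasing functions on $\mathcal{X}$, $\langle f,g\rangle=\sum_x\pi(x)f(x)g(x)$ and $(Kf)(x)=\sum_yK(x,y)f(y)$. A kernel $K$ is stochastically monotone if $Kf\in\mathcal{M}$ for all $f\in\mathcal{M}$. For Markov kernels $K,L$ on $\mathcal{X}$ with stationary distribution $\pi$, $K\preceq L$ means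 $\langle Kf,g\rangle\le\langle Lf,g\rangle$ for all $f,g\in\mathcal{M}$. *)

(* Defs.v *)
From HB Require Import structures.
From mathcomp Require Import all_boot all_order all_algebra.

Set Implicit Arguments.
Unset Strict Implicit.
Unset Printing Implicit Defensive.

Import Order.TTheory GRing.Theory Num.Theory.
Local Open Scope ring_scope.

(* A copy of {ffun V -> S}, on which MathComp puts no order. *)
Definition config (V : finType) (d : Order.disp_t) (S : finPOrderType d) : Type :=
  {ffun V -> S}.

Section ConfigOrder.
Variables (V : finType) (d : Order.disp_t) (S : finPOrderType d).
Implicit Types x y z : config V S.

HB.instance Definition _ := Finite.on (config V S).

Definition config_le x y := [forall w : V, (x w <= y w)%O].

Fact config_le_refl : reflexive config_le.
Proof. by move=> x; apply/forallP. Qed.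

Fact config_le_anti : antisymmetric config_le.
Proof.
move=> x y /andP[/forallP xy /forallP yx].
by apply/ffunP => w; apply/le_anti; rewrite xy yx.
Qed.

Fact config_le_trans : transitive config_le.
Proof.
move=> y x z /forallP xy /forallP yz.
by apply/forallP => w; apply: le_trans (xy w) (yz w).
Qed.

HB.instance Definition _ := Order.Le_isPOrder.Build d (config V S)
  config_le_refl config_le_anti config_le_trans.

Lemma config_leP x y : reflect (forall w, (x w <= y w)%O) (x <= y)%O.
Proof. exact: forallP. Qed.

End ConfigOrder.

Section FinitePoset.
Variables (R : realFieldType) (d : Order.disp_t) (T : finPOrderType d).
Implicit Types (rho pi : T -> R) (f g : T -> R) (K L : T -> T -> R).

Definition is_pmf rho := (forall i, 0 <= rho i) /\ \sum_i rho i = 1.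

Definition expect rho f := \sum_i rho i * f i.

Definition nonneg_nonincr f :=
  (forall i, 0 <= f i) /\ {homo f : i j / (i <= j)%O >-> j <= i}.

Definition positive_correlations rho := forall f g,
  nonneg_nonincr f -> nonneg_nonincr g ->
  expect rho f * expect rho g <= expect rho (fun i => f i * g i).

Definition stoch_le rho1 rho2 := forall f,
  {homo f : i j / (i <= j)%O >-> i <= j} -> expect rho1 f <= expect rho2 f.

Definition kernel_app K f : T -> R := fun x => \sum_y K x y * f y.

Definition is_markov K := forall x, is_pmf (K x).

Definition stationary pi K := forall y, \sum_x pi x * K x y = pi y.

Definition stoch_monotone K := forall f,
  nonneg_nonincr f -> nonneg_nonincr (kernel_app K f).

Definition id_kernel : T -> T -> R := fun x y => (x == y)%:R.

Definition inner pi f g := \sum_x pi x * f x * g x.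

(* Meant for Markov kernels with stationary distribution pi; see the lemmas
   [update_kernel_markov], [update_kernel_stationary], [id_kernel_markov] and
   [id_kernel_stationary]. *)
Definition kernel_le pi K L := forall f g,
  nonneg_nonincr f -> nonneg_nonincr g ->
  inner pi (kernel_app K f) g <= inner pi (kernel_app L f) g.

Lemma id_kernel_markov : is_markov id_kernel.
Proof.
move=> x; split=> [y|]; first exact: ler0n.
rewrite (bigD1 x) //= /id_kernel eqxx big1 ?addr0 // => y.
by rewrite eq_sym => /negPf->.
Qed.

Lemma id_kernel_stationary pi : stationary pi id_kernel.
Proof.
move=> y; rewrite (bigD1 y) //= /id_kernel eqxx mulr1 big1 ?addr0 // => x.
by move=> /negPf->; rewrite mulr0.
Qed.

End FinitePoset.

Section SpinSystem.
Variables (R : realFieldType) (V : finType) (d : Order.disp_t).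
Variable S : finPOrderType d.
Implicit Types (pi f : config V S -> R) (v w : V) (x y : config V S) (s : S).

(* The set [x]: the configurations agreeing with x at all sites other than v. *)
Definition agree_off v x : {set config V S} :=
  [set y : config V S | [forall w, (w != v) ==> (y w == x w)]].

Definition set_spin v x s : config V S :=
  [ffun w => if w == v then s else x w].

Definition class_mass pi v x := \sum_(y in agree_off v x) pi y.

(* The conditional law of the spin at v given that the spins at the other sites
   are those of x; it does not depend on x v. *)
Definition cond_law pi v x : S -> R :=
  fun s => pi (set_spin v x s) / class_mass pi v x.

Definition monotone_pmf pi := forall v x y,
  (forall w, w != v -> (x w <= y w)%O) ->
  stoch_le (cond_law pi v x) (cond_law pi v y).

Definition update_kernel pi v : config V S -> config V S -> R :=
  fun x y => (y \in agree_off v x)%:R * (pi y / class_mass pi v x).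

Lemma agree_offP v x y :
  reflect (forall w, w != v -> y w = x w) (y \in agree_off v x).
Proof.
rewrite inE; apply: (iffP forallP) => [h w nwv|h w].
  by apply/eqP; apply: (implyP (h w)).
by apply/implyP => nwv; rewrite h.
Qed.

Lemma agree_off_sym v x y : (y \in agree_off v x) = (x \in agree_off v y).
Proof. by apply/agree_offP/agree_offP => h w nwv; rewrite h. Qed.

Lemma agree_off_eq v x y : y \in agree_off v x -> agree_off v y = agree_off v x.
Proof.
move=> /agree_offP h; apply/setP => z.
by apply/agree_offP/agree_offP => hz w nwv; rewrite hz // h.
Qed.

Lemma sum_agree_off v x f :
  \sum_(y in agree_off v x) f y = \sum_s f (set_spin v x s).
Proof.
rewrite (reindex_onto (set_spin v x) (fun y => y v)) /=.
  apply: eq_bigl => s; rewrite ffunE !eqxx andbT.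
  by apply/agree_offP => w /negPf nwv; rewrite ffunE nwv.
move=> y /agree_offP h; apply/ffunP => w; rewrite ffunE.
by case: eqVneq => [->|/h].
Qed.

Lemma class_mass_gt0 pi v x : (forall z, 0 < pi z) -> 0 < class_mass pi v x.
Proof.
move=> pi0; rewrite /class_mass (bigD1 x) /=; last by apply/agree_offP.
by rewrite ltr_wpDr // sumr_ge0 // => y _; apply: ltW.
Qed.

Lemma cond_law_pmf pi v x : (forall z, 0 < pi z) -> is_pmf (cond_law pi v x).
Proof.
move=> pi0; split=> [s|].
  by rewrite divr_ge0 // ltW // class_mass_gt0.
by rewrite -mulr_suml -sum_agree_off divff // gt_eqF // class_mass_gt0.
Qed.

Lemma kernel_app_update pi v f x :
  kernel_app (update_kernel pi v) f x =
  expect (cond_law pi v x) (fun s => f (set_spin v x s)).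
Proof.
rewrite /kernel_app (bigID (mem (agree_off v x))) /= addrC big1 ?add0r.
  rewrite /expect -(sum_agree_off v x (fun y => pi y / class_mass pi v x * f y)).
  by apply: eq_bigr => y yx; rewrite /update_kernel yx mul1r.
by move=> y /negPf yx; rewrite /update_kernel yx !mul0r.
Qed.

Lemma update_kernel_markov pi v :
  (forall z, 0 < pi z) -> is_markov (update_kernel pi v).
Proof.
move=> pi0 x; split=> [y|].
  by rewrite mulr_ge0 ?ler0n // divr_ge0 // ltW // class_mass_gt0.
have := kernel_app_update pi v (fun=> 1) x; rewrite /kernel_app /expect.
under eq_bigr do rewrite mulr1.
move=> ->; under eq_bigr do rewrite mulr1.
by case: (cond_law_pmf v x pi0).
Qed.

Lemma update_kernel_stationary pi v :
  (forall z, 0 < pi z) -> stationary pi (update_kernel pi v).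
Proof.
move=> pi0 y; rewrite (bigID (mem (agree_off v y))) /= addrC big1 ?add0r.
  rewrite (eq_bigr (fun x => pi x * (pi y / class_mass pi v y))).
    rewrite -mulr_suml -/(class_mass pi v y) mulrC divfK //.
    by rewrite gt_eqF // class_mass_gt0.
  move=> x xy; rewrite /update_kernel agree_off_sym xy mul1r.
  by rewrite /class_mass (agree_off_eq xy).
by move=> x /negPf xy; rewrite /update_kernel agree_off_sym xy mul0r mulr0.
Qed.

Lemma update_kernel_stoch_monotone pi v :
  (forall z, 0 < pi z) -> monotone_pmf pi -> stoch_monotone (update_kernel pi v).
Proof.
move=> pi0 mono f [f0 fd]; split=> [x|x y xy].
  apply: sumr_ge0 => y _; rewrite mulr_ge0 //.
  by case: (update_kernel_markov v pi0 x).
have {}xy := config_leP _ _ xy; rewrite !kernel_app_update.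
apply: (@le_trans _ _ (expect (cond_law pi v x) (fun s => f (set_spin v y s)))).
  have := mono v x y (fun w _ => xy w) (fun s => - f (set_spin v y s)).
  rewrite /expect !(eq_bigr _ (fun _ _ => mulrN _ _)) !sumrN lerN2; apply.
  move=> s t st; rewrite lerN2; apply: fd; apply/config_leP => w.
  by rewrite !ffunE; case: eqP.
apply: ler_sum => s _; apply: ler_wpM2l; first by case: (cond_law_pmf v x pi0).
by apply: fd; apply/config_leP => w; rewrite !ffunE; case: eqP.
Qed.

End SpinSystem.

(* Main.v *)
Require Import Defs.
From mathcomp Require Import all_boot all_order all_algebra.

Set Implicit Arguments.
Unset Strict Implicit.
Unset Printing Implicit Defensive.

Import Order.TTheory GRing.Theory Num.Theory.
Local Open Scope ring_scope.

(** Write K for the update kernel at v.  Since K f (x) is the conditional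
    expectation of f given the spins of x off v, it is constant on each class
    of configurations agreeing off v, and so K (K f * g) = K f * K g
    ([kernel_app_update_pull_out]).  As K preserves pi-averages
    ([sum_stationary]), this turns <K f, g> into the pi-average of K f * K g,
    while <f, g> is the pi-average of K (f * g).  Within a class a monotone f
    is a monotone function of the single spin at v, so positive correlations
    of the conditional law say exactly that K f * K g <= K (f * g) pointwise
    ([update_kernel_mul_le]); averaging against pi concludes. *)

Section FinitePoset.
Variables (R : realFieldType) (d : Order.disp_t) (T : finPOrderType d).
Implicit Types (pi f : T -> R) (K : T -> T -> R).

Lemma kernel_app_id f x : kernel_app (@id_kernel R _ _) f x = f x.
Proof.
rewrite /kernel_app (bigD1 x) //= /id_kernel eqxx mul1r big1 ?addr0 // => y.
by rewrite eq_sym => /negPf->; rewrite mul0r.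
Qed.

Lemma sum_stationary pi K f : stationary pi K ->
  \sum_x pi x * kernel_app K f x = \sum_x pi x * f x.
Proof.
move=> piK; rewrite [RHS](eq_bigr (fun y => \sum_x pi x * K x y * f y)).
  rewrite exchange_big /=; apply: eq_bigr => x _.
  by rewrite mulr_sumr; apply: eq_bigr => y _; rewrite mulrA.
by move=> y _; rewrite -mulr_suml piK.
Qed.

End FinitePoset.

Section SpinSystem.
Variables (R : realFieldType) (V : finType) (d : Order.disp_t).
Variable S : finPOrderType d.
Implicit Types (pi f g : config V S -> R) (v : V) (x : config V S) (s t : S).

Lemma set_spin_set v x s t : set_spin v (set_spin v x s) t = set_spin v x t.
Proof. by apply/ffunP => w; rewrite !ffunE; case: eqP. Qed.

Lemma set_spin_agree_off v x s : set_spin v x s \in agree_off v x.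
Proof. by apply/agree_offP => w /negPf nwv; rewrite ffunE nwv. Qed.

Lemma nonneg_nonincr_set_spin f v x :
  nonneg_nonincr f -> nonneg_nonincr (fun s => f (set_spin v x s)).
Proof.
case=> f0 fd; split=> [s|s t st]; first exact: f0.
by apply: fd; apply/config_leP => w; rewrite !ffunE; case: eqP.
Qed.

Lemma kernel_app_update_set_spin pi v f x s :
  kernel_app (update_kernel pi v) f (set_spin v x s) =
  kernel_app (update_kernel pi v) f x.
Proof.
rewrite !kernel_app_update; apply: eq_bigr => t _.
rewrite /cond_law /class_mass set_spin_set.
by rewrite (agree_off_eq (set_spin_agree_off v x s)).
Qed.

(** The rule of taking out what is known, for conditional expectations given
    the spins off v. *)
Lemma kernel_app_update_pull_out pi v f g x :
  let K := update_kernel pi v in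
  kernel_app K (fun y => kernel_app K f y * g y) x =
  kernel_app K f x * kernel_app K g x.
Proof.
rewrite /= kernel_app_update (kernel_app_update pi v g) mulr_sumr.
by apply: eq_bigr => s _; rewrite kernel_app_update_set_spin mulrCA.
Qed.

Lemma update_kernel_mul_le pi v f g x :
    positive_correlations (cond_law pi v x) ->
    nonneg_nonincr f -> nonneg_nonincr g ->
  let K := update_kernel pi v in
  kernel_app K f x * kernel_app K g x <= kernel_app K (fun y => f y * g y) x.
Proof.
by move=> pc fM gM; rewrite /= !kernel_app_update;
   apply: pc; apply: nonneg_nonincr_set_spin.
Qed.

End SpinSystem.

Theorem theorem8p3 (R : realFieldType) (V : finType) (d : Order.disp_t)
    (S : finPOrderType d) (pi : config V S -> R)
    (pi_pmf : is_pmf pi) (pi_gt0 : forall x, 0 < pi x)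
    (pi_monotone : monotone_pmf pi) (v : V)
    (pi_poscorr : forall x, positive_correlations (cond_law pi v x)) :
  kernel_le pi (update_kernel pi v) (@id_kernel R _ _).
Proof.
move=> f g fM gM; have piK := update_kernel_stationary v pi_gt0.
rewrite /inner; under eq_bigr do rewrite -mulrA.
under [leRHS]eq_bigr do rewrite kernel_app_id -mulrA.
rewrite -(sum_stationary _ piK) -[leRHS](sum_stationary _ piK).
apply: ler_sum => x _; rewrite kernel_app_update_pull_out.
by apply: ler_wpM2l; [apply: ltW | apply: update_kernel_mul_le].
Qed.
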